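(* Let $p$ be a prime, $q=p^n$, and let $k$ be a positive divisor of $n$. Let $\mathcal{U}\subseteq\mathbb{F}_q$ be an $\mathbb{F}_{p^k}$-vector space such that $1\in\mathcal{U}$ and $\#\mathcal{U}>2$, and let $d\le n/k$ be the smallest positive integer for which $\mathcal{U}\subseteq\mathbb{F}_{p^{dk}}$. If $A(x)=\prod_{u\in\mathcal{U}}(x-u)$, then there exists a monic $p^k$-linearized polynomial $M\in\mathbb{F}_q[x]$ such that $$A(M(x))=M(A(x))=x^{p^{dk}}-x.$$ Moreover, $\mathbb{F}_{p^{dk}}\subseteq\mathbb{F}_q$ and $$\mathcal{P}(\mathcal{U},q)=\{M(f(x)) : f\in\mathcal{P}(\mathbb{F}_{p^{dk}},q)\}.$$
   Context: All finite fields of characteristic $p$ are taken inside a fixed algebraic closure $\overline{\mathbb{F}}_q$ of $\mathbb{F}_q$. For $F\in\mathbb{F}_q[x]$, $V_F=\{F(\alpha):\alpha\in\mathbb{F}_q\}$. A polynomial $F\in\mathbb{F}_q[x]$ of positive degree is a minimal value set polynomial (MVSP) over $\mathbb{F}_q$ if $\#V_F=\lfloor (q-1)/\deg F\rfloor+1$. For a nonempty $S\subseteq\mathbb{F}_q$, $\mathcal{P}(S,q)$ denotes the set of all MVSPs $F\in\mathbb{F}_q[x]$ with $V_F=S$. A polynomial is called $p^k$-linearized if it is of the form $\sum_{i=0}^s a_i x^{p^{ki}}\in\overline{\mathbb{F}}_q[x]$. *)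

(* Defs.v *)
From mathcomp Require Import all_boot all_algebra separable.

Set Implicit Arguments.
Unset Strict Implicit.
Unset Printing Implicit Defensive.

Import GRing.Theory.
Local Open Scope ring_scope.

(* The finite subfield with N elements of a field L.  When L is algebraically
   closed of characteristic p and N = p ^ m with 0 < m, this really is a
   subfield of L with N elements (GF_subfield), and it is the only one
   (GF_unique). *)
Definition GF (L : fieldType) (N : nat) : {pred L} :=
  [pred x : L | x ^+ N == x].
Arguments GF : clear implicits.

Lemma GF_subfield (L : closedFieldType) (p m : nat) :
    p \in [pchar L] -> (0 < m)%N ->
  divring_closed (GF L (p ^ m)) /\
  exists s : seq L, [/\ uniq s, size s = (p ^ m)%N & s =i GF L (p ^ m)].
Proof.
move=> pL m0; have p_pr := pcharf_prime pL; set N := (p ^ m)%N.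
have chN : [pchar L].-nat N by rewrite /N pnatX pnatE // pL.
have N_gt1 : (1 < N)%N by rewrite -(exp1n m) ltn_exp2r // prime_gt1.
have N0 : N%:R = 0 :> L by rewrite /N natrX (pcharf0 pL) expr0n -[m]prednK.
have N_gt0 : (0 < N)%N by apply: ltnW.
have exprN (x : L) : (- x) ^+ N = - x ^+ N.
  apply/eqP; rewrite -addr_eq0 -exprDn_pchar // addNr expr0n.
  by rewrite -[N]prednK.
split.
  split; first by rewrite inE expr1n.
  - move=> x y; rewrite !inE => /eqP xN /eqP yN.
    by rewrite exprDn_pchar // exprN xN yN.
  - move=> x y; rewrite !inE => /eqP xN /eqP yN.
    by rewrite exprMn exprVn xN yN.
pose P : {poly L} := 'X^N - 'X.
have szX : (size (- 'X : {poly L}) < size ('X^N : {poly L}))%N.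
  by rewrite size_polyN size_polyX size_polyXn ltnS.
have sP : size P = N.+1 by rewrite /P size_polyDl // size_polyXn.
have lP : lead_coef P = 1 by rewrite /P lead_coefDl // lead_coefXn.
have [s Ps] := closed_field_poly_normal P; rewrite lP scale1r in Ps.
exists s; split.
- rewrite -separable_prod_XsubC -Ps separable_poly.unlock /P derivB derivXn derivX.
  rewrite -mulr_natr -polyC_natr N0 mulr0 sub0r.
  by rewrite coprimep_sym -scaleN1r coprimepZl ?oppr_eq0 ?oner_eq0 // coprime1p.
- by have := sP; rewrite Ps size_prod_XsubC => -[].
- by move=> x; rewrite -root_prod_XsubC -Ps inE rootE !hornerE subr_eq0.
Qed.

Lemma GF_unique (L : fieldType) (N : nat) (K : {pred L}) (s : seq L) :
    divring_closed K -> uniq s -> size s = N -> s =i K ->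
  K =i GF L N.
Proof.
move=> [K1 KB KV] us sN sK.
have K0 : 0 \in K by rewrite -(subrr 1) KB.
have KM x y : x \in K -> y \in K -> x * y \in K.
  move=> Kx Ky; rewrite -[y]invrK; apply: (KV) => //.
  by rewrite -[y^-1]mul1r KV.
have s0 : 0 \in s by rewrite sK.
pose t := rem 0 s.
have ut : uniq t by rewrite rem_uniq.
have tE x : (x \in t) = (x != 0) && (x \in K).
  by rewrite /t mem_rem_uniq // !inE sK.
have st : N = (size t).+1.
  by rewrite /t size_rem // -sN prednK //; case: (s) s0.
have KGF x : x \in K -> x ^+ N == x.
  move=> Kx; have [->|x0] := eqVneq x 0; first by rewrite st expr0n.
  have ux : uniq [seq x * y | y <- t] by rewrite map_inj_uniq //; apply: mulfI.
  have sub : {subset [seq x * y | y <- t] <= t}.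
    move=> _ /mapP[y + ->]; rewrite !tE => /andP[y0 Ky].
    by rewrite mulf_neq0 // KM.
  have pt : perm_eq [seq x * y | y <- t] t.
    apply: uniq_perm => //.
    have le_t : (size t <= size [seq (x * y)%R | y <- t])%N by rewrite size_map.
    by have [_ e] := uniq_min_size ux sub le_t.
  have h : x ^+ size t * \prod_(y <- t) y = \prod_(y <- t) y.
    rewrite -[RHS](perm_big _ pt) big_map big_split /=.
    by rewrite big_const_seq count_predT iter_mulr_1.
  have nz : \prod_(y <- t) y != 0.
    rewrite prodf_seq_neq0; apply/allP => y; rewrite tE => /andP[y0 _].
    by rewrite y0 implybT.
  by rewrite st exprS (mulIf nz (etrans h (esym (mul1r _)))) mulr1.
move=> x; apply/idP/idP => [/KGF //|xN].
have N_gt1 : (1 < N)%N.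
  have: 1 \in t by rewrite tE oner_eq0.
  by rewrite st; case: (t).
pose P : {poly L} := 'X^N - 'X.
have sP : size P = N.+1.
  by rewrite /P size_polyDl size_polyXn // size_polyN size_polyX ltnS.
apply/negPn/negP => xK.
suff: (size (x :: s) < size P)%N by rewrite sP /= sN ltnn.
apply: max_poly_roots; first by rewrite -size_poly_eq0 sP.
  apply/allP => y; rewrite inE rootE !hornerE subr_eq0.
  by case/predU1P => [->//|]; rewrite sK => /KGF.
by rewrite /= sK xK.
Qed.

(* GF L N \cap F_q, as a subset of F_q = F embedded in L by iota. *)
Definition GFset (F : finFieldType) (L : fieldType) (iota : {rmorphism F -> L})
    (N : nat) : {set F} :=
  [set a : F | iota a \in GF L N].

(* U is an F_N-vector subspace of F, for F_N a subfield of F. *)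
Definition is_GF_subspace (F : finFieldType) (L : fieldType)
    (iota : {rmorphism F -> L}) (N : nat) (U : {set F}) : Prop :=
  [/\ 0 \in U,
      {in U &, forall u v : F, u + v \in U} &
      {in GFset iota N & U, forall a u : F, a * u \in U}].

Definition value_set (F : finFieldType) (f : {poly F}) : {set F} :=
  [set f.[a] | a : F].

(* (size f).-1 is the degree of f. *)
Definition MVSP (F : finFieldType) (f : {poly F}) : Prop :=
  (1 < size f)%N /\
  #|value_set f| = ((#|F| - 1) %/ (size f).-1 + 1)%N.

Definition MVSP_with_values (F : finFieldType) (S : {set F}) (f : {poly F}) :
    Prop :=
  MVSP f /\ value_set f = S.

Definition linearized (R : nzRingType) (p k : nat) (f : {poly R}) : Prop :=
  exists (s : nat) (a : nat -> R),
    f = \sum_(0 <= i < s.+1) a i *: 'X^(p ^ (k * i)).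

(* Main.v *)
Require Import Defs.
From mathcomp Require Import all_boot all_algebra all_field.

Import GRing.Theory.
Local Open Scope ring_scope.

(**
Write P = p^k, Q = P^d, q = #|F|.  The polynomial A of U is P-linearized, so
A' is a constant c, and a degree count shows that g is an MVSP with value set U
if and only if g is not constant and A(g) = -c (x^q - x) g'.  Since
A(M(x)) = x^Q - x, an MVSP f with value set F_Q satisfies the equation of F_Q,
f^Q - f = (x^q - x) f', and M(f) then satisfies that of U.

Conversely let g satisfy the equation of U.  Let P not divide e, let the
coefficient g_e be nonzero, and put G = \sum_j g_(P^j e) X^(P^j).  Comparing
coefficients at the exponents P^j e gives A(G) = c g_e X - c g_e0 X^(P^s) with
P^s e = q - 1 + e0.  After scaling, the roots of the right-hand side form
F_(P^s) and G maps them onto U; since 1 \in U this forces U \subset F_(P^s),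
hence d | s, and g_e0 = g_e^(P^s).  Consequently
f = -c \sum_e \sum_(j < s(e)/d) (g_e X^e)^(Q^j) telescopes to
f^Q - f = -c (x^q - x) g' = A(g), so A(M(f) - g) = 0, and M(f) - g is a
constant in U = M(F_Q).
*)

(** * Frobenius powers and linearized polynomials *)

Lemma pchar_poly_nat (R : nzRingType) (N : nat) :
  [pchar R].-nat N -> [pchar {poly R}].-nat N.
Proof. by rewrite (eq_pnat _ (pchar_poly R)). Qed.

Lemma coef_exp_pchar (R : comNzRingType) (N : nat) (f : {poly R}) (e : nat) :
    [pchar R].-nat N ->
  (f ^+ N)`_e = if (N %| e)%N then f`_(e %/ N) ^+ N else 0.
Proof.
move=> chN; have N0 : (0 < N)%N by case/andP: chN.
have z0 : 0 ^+ N = 0 :> R by rewrite expr0n -[N]prednK.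
elim/poly_ind: f e => [|f c IH] e.
  by rewrite expr0n gtn_eqF // !coef0 z0 if_same.
rewrite exprDn_pchar ?pchar_poly_nat // exprMn -polyC_exp coefD coefMXn coefC.
have [ltN|leN] := ltnP e N.
  rewrite add0r; have [->|e0] := eqVneq e 0%N.
    by rewrite dvdn0 div0n coefD coefMX coefC add0r.
  by rewrite (gtnNdvd _ ltN) // lt0n.
have /negPf-> : e != 0%N by rewrite -lt0n (leq_trans N0).
rewrite addr0 IH; set e' := (e - N)%N; have -> : e = (e' + N)%N by rewrite subnK.
rewrite dvdn_addl //; case: ifP => // dv; rewrite divnDr // divnn N0 addn1.
by rewrite coefD coefMX coefC /= addr0.
Qed.

Lemma exprX_fix {R : nzRingType} {N : nat} {x : R} (i : nat) :
  x ^+ N = x -> x ^+ (N ^ i) = x.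
Proof. by move=> xN; elim: i => [|i IH]; rewrite ?expr1 // expnS exprM xN. Qed.

(* An [N]-linearized polynomial, expressed through its support. *)
Definition power_supported {R : nzRingType} (N : nat) (f : {poly R}) : Prop :=
  forall e, f`_e != 0 -> exists i, e = (N ^ i)%N.

Section PowerSupported.

Context {R : comNzRingType} {N : nat}.
Hypotheses (chN : [pchar R].-nat N) (N_gt1 : (1 < N)%N).

Lemma power_supported_comp (f g h : {poly R}) (l : R) :
    power_supported N f -> l ^+ N = l ->
  f \Po (g + l *: h) = f \Po g + l *: (f \Po h).
Proof.
move=> fN lN; rewrite !comp_polyE scaler_sumr -big_split /=.
apply: eq_bigr => e _; have [->|] := eqVneq (f`_e) 0.
  by rewrite !scale0r scaler0 addr0.
case/fN => i ->; rewrite exprDn_pchar ?pnatX ?pchar_poly_nat ?chN // exprZn.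
by rewrite (exprX_fix i lN) scalerDr !scalerA mulrC.
Qed.

Lemma power_supported_horner (f : {poly R}) (x y l : R) :
    power_supported N f -> l ^+ N = l ->
  f.[x + l * y] = f.[x] + l * f.[y].
Proof.
move=> fN lN; apply: polyC_inj.
rewrite polyCD polyCM -!comp_polyCr mul_polyC -power_supported_comp //.
by rewrite -mul_polyC -polyCM -polyCD.
Qed.

Lemma power_supported_exp (f : {poly R}) :
  power_supported N f -> power_supported N (f ^+ N).
Proof.
move=> fN e; rewrite coef_exp_pchar //; case: dvdnP => [[m ->]|_]; last first.
  by rewrite eqxx.
rewrite mulnK ?(ltnW N_gt1) // => fm; have : f`_m != 0.
  by apply: contraNneq fm => ->; rewrite expr0n -[N]prednK ?(ltnW N_gt1).
by case/fN => i ->; exists i.+1; rewrite expnSr.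
Qed.

(** The exponents N^i with i > 0 vanish in R, which leaves only the linear term. *)
Lemma power_supported_deriv (f : {poly R}) :
  power_supported N f -> f^`() = (f`_1)%:P.
Proof.
move=> fN; apply/polyP => i; rewrite coef_deriv coefC.
case: i => [|i] /=; first by rewrite mulr1n.
have [->|/fN[[|j]]] := eqVneq (f`_i.+2) 0; first by rewrite mul0rn.
  by rewrite expn0.
move=> eN; have NR0 : N%:R = 0 :> R.
  have [p pN] : exists p, p \in primes N.
    by exists (pdiv N); rewrite mem_primes pdiv_prime // pdiv_dvd ltnW.
  have pR : p \in [pchar R].
    case/andP: chN => _ /allP; exact.
  by apply/eqP; rewrite -(dvdn_pcharf pR); move: pN; rewrite mem_primes => /and3P[].
by rewrite {2}eN -mulr_natr natrX NR0 expr0n mulr0.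
Qed.

(** As N-th powering is additive, the term of f at X^(N^i) contributes only at multiples of N^i.
    Indices below [size f] suffice, because i < N^i. *)
Lemma coef_comp_power_supported (f g : {poly R}) (e : nat) :
    power_supported N f ->
  (f \Po g)`_e =
    \sum_(i < size f | (N ^ i %| e)%N) f`_(N ^ i) * g`_(e %/ N ^ i) ^+ (N ^ i).
Proof.
move=> fN; have fE : f = \sum_(i < size f) f`_(N ^ i) *: 'X^(N ^ i).
  apply/polyP => j; rewrite coef_sumMXn.
  have [|/fN[i ji]] := eqVneq (f`_j) 0.
    by move=> fj; rewrite big1 // => i /eqP->.
  have [/leP lef|ltf] := leqP (size f) i.
    have : (size f <= j)%N.
      by rewrite ji (leq_trans (introT leP lef)) // ltnW // ltn_expl.
    move/leq_sizeP/(_ j (leqnn j)) => ->.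
    rewrite big1 // => i' /eqP e'; have := ltn_ord i'.
    move: e'; rewrite ji => /eqP; rewrite eqn_exp2l // => /eqP->.
    by move/leP: lef => lef; rewrite ltnNge lef.
  rewrite (big_pred1 (Ordinal ltf)) ?ji // => i'.
  by rewrite eqn_exp2l // -val_eqE.
rewrite {1}fE raddf_sum coef_sum [RHS]big_mkcond; apply: eq_bigr => i _ /=.
rewrite comp_polyZ rmorphXn /= comp_polyX coefZ coef_exp_pchar ?pnatX ?chN //.
by case: ifP; rewrite ?mulr0.
Qed.

End PowerSupported.

Lemma power_supported_linearized (R : nzRingType) (p k : nat) (f : {poly R}) :
  (1 < p ^ k)%N -> power_supported (p ^ k) f -> linearized p k f.
Proof.
move=> N_gt1 fN; exists (size f), (fun i => f`_(p ^ (k * i))).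
apply/polyP => j; rewrite coef_sumMXn.
have [|nz] := eqVneq (f`_j) 0; first by move=> fj; rewrite big1 // => i /eqP->.
have [i ji] := fN j nz.
have lti : (i < (size f).+1)%N.
  rewrite ltnS ltnW // (leq_trans (ltn_expl i N_gt1)) // -ji ltnW //.
  by rewrite ltnNge; apply: contra nz => /leq_sizeP->.
rewrite big_mkord (big_pred1 (Ordinal lti)) /= ?expnM ?ji // => i'.
by rewrite expnM eqn_exp2l // -val_eqE.
Qed.

(** Let K be the fixed field of N-th powering and G1 the rescaled G. Any x with A(G1(x)) = 0 lies in
    K. As A(0) = 0, this covers the roots of G1, so G1 is its leading coefficient c times a monic
    polynomial over K, and each root of A, being a value of G1 at a point of K, lies in cK. The root
    1 puts c in K. Leading coefficients of A(G1) then give (br)^N = br, which amounts to a =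
    -b^N. *)
Lemma root_comp_fixed (L : closedFieldType) (N : nat) (A G : {poly L})
    (a b : L) :
    [pchar L].-nat N -> (1 < N)%N -> A \is monic -> A.[0] = 0 -> A.[1] = 0 ->
    a != 0 -> b != 0 -> A \Po G = a *: 'X^N + b *: 'X ->
  (forall u, A.[u] = 0 -> u ^+ N = u) /\ a = - b ^+ N.
Proof.
move=> chN N_gt1 Amon A0 A1 a0 b0 AG.
(* The substitution X -> r X turns the right-hand side into a multiple of
   X - X^N, so that the roots of the composite lie in the fixed field of X^N. *)
have [r rE] : exists r, r ^+ N.-1 = - b / a.
  have /closed_rootP[r] : size ('X^(N.-1) - (- b / a)%:P : {poly L}) != 1%N.
    by rewrite size_XnsubC -subn1 ?subn_gt0 // eqSS subn_eq0 -ltnNge.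
  by rewrite rootE !hornerE subr_eq0 => /eqP; exists r.
have r0 : r != 0.
  apply: contraTneq isT => r0; move: rE; rewrite r0 expr0n.
  rewrite -subn1 subn_eq0 leqNgt N_gt1 => /esym/eqP.
  by rewrite mulf_eq0 oppr_eq0 (negPf b0) invr_eq0 (negPf a0).
have arN : a * r ^+ N = - (b * r).
  by rewrite -[N]prednK ?(ltnW N_gt1) // exprSr mulrA rE mulrCA divff // mulr1 mulNr.
pose G1 := G \Po (r *: 'X).
have AG1 : A \Po G1 = (b * r) *: ('X - 'X^N : {poly L}).
  rewrite /G1 comp_polyA AG comp_polyD !comp_polyZ comp_polyX rmorphXn /=.
  by rewrite comp_polyX exprZn !scalerA arN scaleNr addrC scalerBr.
have br0 : b * r != 0 by rewrite mulf_neq0.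
have AG1h x : A.[G1.[x]] = b * r * (x - x ^+ N).
  by rewrite -horner_comp AG1 !hornerE.
have AG1_fix x : A.[G1.[x]] = 0 -> x ^+ N = x.
  by rewrite AG1h => /eqP; rewrite mulf_eq0 (negPf br0) subr_eq0 => /eqP.
have sG1 : (1 < size G1)%N.
  rewrite ltnNge; apply/negP => /size1_polyC G1C.
  have := congr1 (fun f : {poly L} => f`_1) AG1.
  rewrite G1C comp_polyCr coefC coefZ coefB coefX coefXn /=.
  by rewrite (ltn_eqF N_gt1) subr0 mulr1 => /eqP; rewrite ?[0 == _]eq_sym (negPf br0).
have [s G1s] := closed_field_poly_normal G1; set c := lead_coef G1 in G1s.
have c0 : c != 0 by rewrite lead_coef_eq0 -size_poly_gt0 ltnW.
have s_fix v : v \in s -> v ^+ N = v.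
  move=> sv; apply: AG1_fix; rewrite G1s hornerZ (_ : _.[v] = 0) ?mulr0 ?A0 //.
  by apply/rootP; rewrite root_prod_XsubC.
have rootsE u : A.[u] = 0 -> exists2 w, w ^+ N = w & u = c * w.
  move=> Au; have /closed_rootP[x] : size (G1 - u%:P) != 1%N.
    rewrite size_polyDl ?gtn_eqF // size_polyN.
    by rewrite (leq_ltn_trans _ sG1) // size_polyC; case: eqP.
  rewrite rootE !hornerE subr_eq0 => /eqP xu.
  exists (\prod_(v <- s) (x - v)); last first.
    by rewrite -xu G1s hornerZ horner_prod; under eq_bigr do rewrite !hornerE.
  rewrite -prodrXl; apply: eq_big_seq => v sv.
  by rewrite exprDn_pchar // exprNn_pchar // (s_fix v sv) AG1_fix ?xu.
have cN : c ^+ N = c.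
  have [w wN w1] := rootsE 1 A1; have w0 : w != 0.
    by apply: contra_eq_neq w1 => ->; rewrite mulr0 oner_neq0.
  by rewrite -[c](mulfK w0) -w1 mul1r exprVn wN.
split=> [u /rootsE[w wN ->]|]; first by rewrite exprMn cN wN.
have brN : (b * r) ^+ N = b * r.
  have : lead_coef (A \Po G1) = c ^+ (size A).-1.
    by rewrite lead_coef_comp // (monicP Amon) mul1r.
  rewrite AG1 lead_coefZ addrC lead_coefDl; last first.
    by rewrite size_polyN size_polyXn size_polyX ltnS.
  rewrite lead_coefN lead_coefXn mulrN1 => /(canRL opprK) ->.
  by rewrite exprNn_pchar // exprAC cN.
apply: (mulIf (expf_neq0 N r0)).
by rewrite arN mulNr -exprMn brN.
Qed.

(** * Vanishing polynomials and the differential equation of an MVSP *)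

Section SetPoly.

Context {F : finFieldType}.
Implicit Types (U : {set F}) (f g : {poly F}).

Definition set_poly U : {poly F} := \prod_(u in U) ('X - u%:P).

Lemma size_set_poly U : size (set_poly U) = #|U|.+1.
Proof. by rewrite /set_poly -big_enum size_prod_XsubC cardE. Qed.

Lemma set_poly_monic U : set_poly U \is monic.
Proof. exact: monic_prod_XsubC. Qed.

Lemma set_poly_eq0 U x : ((set_poly U).[x] == 0) = (x \in U).
Proof. by rewrite -rootE /set_poly -big_enum root_prod_XsubC mem_enum. Qed.

Lemma eq_set_poly U f :
    f \is monic -> size f = #|U|.+1 -> {in U, forall x, f.[x] = 0} ->
  f = set_poly U.
Proof.
move=> fmon sf fU; have := @all_roots_prod_XsubC F f (enum U).
rewrite -cardE sf uniq_rootsE enum_uniq (monicP fmon) scale1r big_enum.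
by apply=> //; apply/allP => x; rewrite mem_enum => /fU/eqP.
Qed.

Lemma set_poly_setT : set_poly [set: F] = 'X^#|F| - 'X.
Proof. by rewrite finField_genPoly /set_poly; apply: eq_bigl => x; rewrite inE. Qed.

(** Translation by 1 permutes F, so adding #F to the sum of all elements does not change it. *)
Lemma natr_card_finField : #|F|%:R = 0 :> F.
Proof.
apply: (addIr (\sum_(x : F) x)); rewrite add0r [RHS](reindex_inj (addrI 1)).
by rewrite big_split sumr_const.
Qed.

Lemma size_genPoly : size ('X^#|F| - 'X : {poly F}) = #|F|.+1.
Proof. by rewrite -set_poly_setT size_set_poly cardsT. Qed.

Lemma deriv_genPoly : ('X^#|F| - 'X : {poly F})^`() = -1.
Proof.
by rewrite derivB derivXn derivX -mulr_natr -polyC_natr natr_card_finField mulr0 sub0r.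
Qed.

Lemma genPoly_dvd g : (forall x, g.[x] = 0) -> 'X^#|F| - 'X %| g.
Proof.
move=> g0; rewrite finField_genPoly -big_enum; apply: uniq_roots_dvdp.
  by apply/allP => x _; apply/rootP.
by rewrite uniq_rootsE enum_uniq.
Qed.

Lemma card_le_value_set g :
  (1 < size g)%N -> (#|F| <= #|value_set g| * (size g).-1)%N.
Proof.
rewrite -[#|F|]sum1_card -sum_nat_const /=; move=> sg.
rewrite (partition_big (horner g) (mem (value_set g))) /=; last first.
  by move=> x _; apply: imset_f.
apply: leq_sum => v _; rewrite sum1_card cardE.
have sgv : size (g - v%:P) = size g.
  by rewrite size_polyDl // size_polyN (leq_ltn_trans (size_polyC_leq1 v)).
rewrite -ltnS prednK ?(ltnW sg) // -sgv; apply: max_poly_roots (enum_uniq _).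
  by rewrite -size_poly_gt0 sgv ltnW.
by apply/allP => x; rewrite mem_enum rootE !hornerE subr_eq0.
Qed.

Lemma set_poly_comp_value_set U g :
  value_set g \subset U <-> forall x, (set_poly U \Po g).[x] = 0.
Proof.
split=> [/subsetP gU x|gU].
  by rewrite horner_comp; apply/eqP; rewrite set_poly_eq0 gU // imset_f.
apply/subsetP => _ /imsetP[x _ ->].
by rewrite -set_poly_eq0 -horner_comp gU.
Qed.

(** Write A for [set_poly U]. Forward: X^q - X divides A(g) with a quotient H of degree below deg g.
    Differentiating A(g) = (X^q - X) H shows that X^q - X divides c g' + H, whose degree is below q,
    so H = -c g'. Backward: the equation puts all values in U, and its degree bounds #U by the least
    possible size of a value set. *)
Lemma MVSP_with_valuesP U (c : F) g :
    (1 < #|U|)%N -> c != 0 -> (set_poly U)^`() = c%:P ->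
  MVSP_with_values U g <->
  (1 < size g)%N /\ set_poly U \Po g = - c *: (('X^#|F| - 'X) * g^`()).
Proof.
move=> U_gt1 c0 dU; set X := 'X^#|F| - 'X.
have X0 : X != 0 by rewrite -size_poly_gt0 size_genPoly.
have szAg : (size (set_poly U \Po g)).-1 = (#|U| * (size g).-1)%N.
  by rewrite size_comp_poly size_set_poly.
have dAg : (set_poly U \Po g)^`() = c *: g^`().
  by rewrite deriv_comp dU comp_polyC mul_polyC.
have szd : (1 < size g)%N -> (size g^`() < size g)%N.
  by move=> sg; rewrite lt_size_deriv // -size_poly_gt0 ltnW.
split=> [[[sg cV] VU]|[sg Ag]]; [split=> //|].
  have F_gt0 : (0 < #|F|)%N by apply/card_gt0P; exists 0.
  have D_gt0 : (0 < (size g).-1)%N by rewrite -subn1 subn_gt0.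
  have /dvdpP[H AgH] : X %| set_poly U \Po g.
    by apply: genPoly_dvd; apply/set_poly_comp_value_set; rewrite VU.
  have leUD : (#|U| * (size g).-1 <= #|F|.-1 + (size g).-1)%N.
    by rewrite -VU cV mulnDl mul1n leq_add2r subn1 leq_divM.
  have sH : (size H < size g)%N.
    have [->|H0] := eqVneq H 0; first by rewrite size_poly0 ltnW.
    move: szAg; rewrite AgH size_mul // size_genPoly addnS /= => szAg.
    move: leUD; rewrite -szAg -(prednK F_gt0) addnS /= addnC leq_add2l => le.
    by rewrite (leq_ltn_trans le) // prednK // ltnW.
  (* With two elements in U, [leUD] yields 2 deg g <= q - 1 + deg g. *)
  have D_lt : ((size g).-1 < #|F|)%N.
    rewrite -ltnS -[X in (_ < X.+1)%N]prednK // !ltnS -(leq_add2r (size g).-1).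
    by apply: leq_trans leUD; rewrite addnn -mul2n leq_mul2r U_gt1 orbT.
  have : c *: g^`() + H = 0.
    apply: contraTeq isT => nz.
    have : X %| c *: g^`() + H.
      apply/dvdpP; exists H^`(); rewrite -dAg AgH derivM deriv_genPoly.
      by rewrite mulrN1 subrK.
    move=> /(dvdp_leq nz); rewrite size_genPoly leqNgt ltnS; apply: contraNN => _.
    rewrite (leq_trans (size_polyD _ _)) // geq_max.
    have le_F : (size g <= #|F|)%N by rewrite -(prednK (ltnW sg)).
    by rewrite (leq_trans (size_scale_leq _ _)) ?(leq_trans _ le_F) // ltnW // szd.
  move/eqP; rewrite addrC addr_eq0 -scaleNr => /eqP HE.
  by rewrite AgH HE mulrC scalerAr.
have VU : value_set g \subset U.
  apply/set_poly_comp_value_set => x.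
  by rewrite Ag hornerZ hornerM hornerD hornerN hornerXn hornerX expf_card subrr mul0r mulr0.
have D_gt0 : (0 < (size g).-1)%N by rewrite -subn1 subn_gt0.
have leUD : (#|U| <= (#|F| - 1) %/ (size g).-1 + 1)%N.
  have Ag0 : set_poly U \Po g != 0.
    by rewrite comp_poly_eq0 // -size_poly_gt0 size_set_poly.
  have g'0 : g^`() != 0.
    by apply: contraNneq Ag0 => g'0; rewrite Ag g'0 mulr0 scaler0.
  have : (#|U| * (size g).-1 < #|F| + (size g).-1)%N.
    rewrite -szAg Ag size_scale ?oppr_eq0 // size_mul // size_genPoly addSn /=.
    rewrite prednK ?addn_gt0 ?size_poly_gt0 ?g'0 ?orbT //.
    by rewrite leq_add2l -ltnS prednK ?szd // ltnW.
  move=> lt; rewrite addnC -leq_subLR leq_divRL // mulnBl mul1n leq_subLR.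
  rewrite addnBA ?subn1; last by apply/card_gt0P; exists 0.
  by rewrite -ltnS prednK ?addn_gt0 ?D_gt0 // [X in (_ < X)%N]addnC.
have geV : ((#|F| - 1) %/ (size g).-1 + 1 <= #|value_set g|)%N.
  rewrite addn1 ltn_divLR // subn1 prednK ?card_le_value_set //.
  by apply/card_gt0P; exists 0.
have VE : value_set g = U.
  by apply/eqP; rewrite eqEcard VU (leq_trans leUD).
by split=> //; split=> //; apply/eqP; rewrite eqn_leq geV VE leUD.
Qed.

End SetPoly.

(** * Subspaces over the field with N elements *)

Section Subspaces.

Context {F : finFieldType} {N : nat}.
Hypotheses (chN : [pchar F].-nat N) (N_gt1 : (1 < N)%N).
Hypothesis card_fix : #|[set x : F | x ^+ N == x]| = N.

(** The scalars are the solutions of l^N = l inside F, so no algebraic closure enters. *)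
Definition fixed_subspace (U : {set F}) : Prop :=
  [/\ 0 \in U, {in U &, forall u v, u + v \in U} &
      forall l u : F, l ^+ N = l -> u \in U -> l * u \in U].

Lemma fixed_subspaceB (U : {set F}) :
  fixed_subspace U -> {in U &, forall u v, u - v \in U}.
Proof.
move=> [_ UD UZ] u v Uu Uv; rewrite UD // -mulN1r UZ //.
by rewrite exprNn_pchar // expr1n.
Qed.

Lemma fixed_subspace_extend (U W : {set F}) (a : F) :
    fixed_subspace U -> fixed_subspace W -> W \subset U ->
    a \in U -> a \notin W -> power_supported N (set_poly W) ->
  exists W' : {set F}, [/\ fixed_subspace W', W' \subset U, W \proper W' &
                           power_supported N (set_poly W')].
Proof.
move=> subU subW WU Ua Wa pW; have [W0 WD WZ] := subW.
have N_gt0 : (0 < N)%N by apply: ltnW.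
have z0 : 0 ^+ N = 0 :> F by rewrite expr0n gtn_eqF.
pose K := [set x : F | x ^+ N == x].
pose h (x : F * F) := x.2 + x.1 * a.
pose W' := h @: setX K W.
have memW' x : reflect (exists l w, [/\ l ^+ N = l, w \in W & x = w + l * a])
                       (x \in W').
  apply: (iffP imsetP) => [[[l w]]|[l [w [lN Ww ->]]]].
    by rewrite !inE /= => /andP[/eqP lN Ww] ->; exists l, w.
  by exists (l, w); rewrite // !inE lN eqxx.
have WsW' : W \subset W'.
  by apply/subsetP => w Ww; apply/memW'; exists 0, w; rewrite mul0r addr0.
have cW' : #|W'| = (N * #|W|)%N.
  rewrite card_in_imset ?cardsX ?card_fix // => -[l w] [l' w'].
  rewrite !inE /h /= => /andP[/eqP lN Ww] /andP[/eqP lN' Ww'] e.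
  have e1 : (l - l') * a = w' - w.
    by rewrite mulrBl; apply/eqP; rewrite subr_eq addrAC eq_sym subr_eq -e addrC.
  have Wla : (l - l') * a \in W by rewrite e1 fixed_subspaceB.
  have [ll'|nll'] := eqVneq (l - l') 0.
    move: e1; rewrite ll' mul0r => /esym/eqP; rewrite subr_eq0 => /eqP->.
    by move/eqP: ll'; rewrite subr_eq0 => /eqP->.
  case/negP: Wa; rewrite -[a](mulKf nll') WZ //.
  by rewrite exprVn exprDn_pchar // exprNn_pchar // lN lN'.
exists W'; split.
- split.
  + exact: (subsetP WsW').
  + move=> _ _ /memW'[l [w [lN Ww ->]]] /memW'[l' [w' [lN' Ww' ->]]].
    apply/memW'; exists (l + l'), (w + w'); rewrite exprDn_pchar // lN lN' WD //.
    by rewrite mulrDl addrACA.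
  + move=> m _ mN /memW'[l [w [lN Ww ->]]].
    apply/memW'; exists (m * l), (m * w); rewrite exprMn lN mN WZ //.
    by rewrite mulrDr mulrA.
- apply/subsetP => _ /memW'[l [w [lN Ww ->]]].
  by case: subU => _ UD UZ; rewrite UD ?UZ // (subsetP WU).
- rewrite properEneq WsW' andbT; apply: contraNneq Wa => ->.
  by apply/memW'; exists 1, 0; rewrite expr1n mul1r add0r.
(* A_W' = A_W^N - A_W(a)^(N-1) A_W when W' = W + K a. *)
set f := set_poly W.
have szf : (size f).-1 = #|W| by rewrite size_set_poly.
have szfN : size (f ^+ N) = (N * #|W|).+1.
  rewrite -[LHS]prednK ?size_poly_gt0 ?expf_neq0 ?monic_neq0 ?set_poly_monic //.
  by rewrite size_exp szf mulnC.
have W_gt0 : (0 < #|W|)%N by apply/card_gt0P; exists 0.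
have lt_sz : (size (- (f.[a] ^+ N.-1 *: f)) < size (f ^+ N))%N.
  rewrite size_polyN (leq_ltn_trans (size_scale_leq _ _)) // size_set_poly.
  by rewrite szfN ltnS -{1}[#|W|]mul1n ltn_mul2r W_gt0.
suff <- : f ^+ N - f.[a] ^+ N.-1 *: f = set_poly W'.
  move=> e; rewrite coefB coefZ => nz.
  have [fe|/pW//] := eqVneq (f`_e) 0; move: nz; rewrite fe mulr0 subr0.
  exact: power_supported_exp.
apply: eq_set_poly.
- by rewrite monicE lead_coefDl // -monicE monic_exp ?set_poly_monic.
- by rewrite size_polyDl // szfN cW'.
move=> _ /memW'[l [w [lN Ww ->]]].
rewrite !hornerE !(power_supported_horner chN) //.
have /eqP-> : f.[w] == 0 by rewrite set_poly_eq0.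
by rewrite add0r exprMn lN mulrCA -exprSr prednK // subrr.
Qed.

(** Starting from {0}, whose polynomial is X, a subspace W of U grows by one dimension at a time;
    the induction is on a lower bound m for its size. *)
Lemma fixed_subspace_power_supported (U : {set F}) :
  fixed_subspace U -> power_supported N (set_poly U).
Proof.
move=> subU; have [U0 _ _] := subU.
suff /(_ #|U|)[] : forall m, (m <= #|U|)%N ->
    exists W : {set F}, [/\ fixed_subspace W, W \subset U, (m <= #|W|)%N &
                            power_supported N (set_poly W)].
- by [].
- by move=> W [_ WU leUW pW]; have /eqP<- : W == U by rewrite eqEcard WU.
elim=> [_|m IH lt_mU].
  exists [set 0]; split; rewrite ?sub1set //.
    split=> [|_ _ /set1P-> /set1P->|l _ _ /set1P->]; by rewrite inE ?addr0 ?mulr0.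
  move=> e; rewrite /set_poly big_set1 subr0 coefX.
  by case: (eqVneq e 1%N) => [->|_]; [exists 0%N | rewrite eqxx].
have [W [subW WU le_mW pW]] := IH (ltnW lt_mU).
have [lt_mW|le_Wm] := ltnP m #|W|; first by exists W.
have /subsetPn[a Ua Wa] : ~~ (U \subset W).
  by apply: contraL lt_mU => /subset_leq_card leUW; rewrite -leqNgt (leq_trans leUW).
have [W' [subW' W'U WW' pW']] := fixed_subspace_extend U W a subU subW WU Ua Wa pW.
by exists W'; split=> //; rewrite (leq_ltn_trans le_mW) // proper_card.
Qed.

(** The polynomial of U is additive with kernel U, so its fibres on W are cosets of U. *)
Lemma card_fixed_subspace_image (U W : {set F}) :
    fixed_subspace U -> fixed_subspace W -> U \subset W ->
  #|W| = (#|horner (set_poly U) @: W| * #|U|)%N.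
Proof.
move=> subU subW /subsetP UW; have pU := fixed_subspace_power_supported U subU.
set f := set_poly U; have [_ WD _] := subW.
rewrite -sum_nat_const -[LHS]sum1_card.
rewrite (partition_big (horner f) (mem (horner f @: W))) /=; last first.
  by move=> x; apply: imset_f.
apply: eq_bigr => _ /imsetP[x Wx ->]; rewrite sum1_card.
rewrite -(card_imset (mem U) (addrI x)) ; apply: eq_card => y.
have fD u v : f.[u + v] = f.[u] + f.[v].
  by rewrite -[v in LHS]mul1r (power_supported_horner chN) ?expr1n ?mul1r.
have fyx : (y - x \in U) = (f.[y] == f.[x]).
  have := fD (y - x) x; rewrite subrK => ->.
  by rewrite -subr_eq0 addrK set_poly_eq0.
apply/idP/imsetP => [/andP[_]|[u Uu ->]].
  by rewrite -fyx => Uyx; exists (y - x); rewrite // addrC subrK.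
apply/andP; split; first by apply: WD => //; apply: UW.
have /eqP fu0 : f.[u] == 0 by rewrite set_poly_eq0.
by rewrite fD fu0 addr0.
Qed.

End Subspaces.

(** * Orbits of exponents under multiplication by N *)

Section Orbits.

Context {F : finFieldType} {L : closedFieldType} {iota : {rmorphism F -> L}}.
Context {N : nat} {A g : {poly F}} {c : F}.
Hypotheses (chN : [pchar F].-nat N) (N_gt1 : (1 < N)%N).
Hypotheses (A_monic : A \is monic) (sA : (2 < size A)%N).
Hypotheses (A0 : A.[0] = 0) (A1 : A.[1] = 0).
Hypotheses (psA : power_supported N A) (dA : A^`() = c%:P) (c0 : c != 0).
Hypotheses (Nq : (N %| #|F|)%N) (sg : (size g <= #|F|)%N).
Hypothesis Ag : A \Po g = - c *: (('X^#|F| - 'X) * g^`()).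

Lemma coef_comp_MVSP e : (0 < e)%N ->
  (A \Po g)`_e = c * (g`_e *+ e)
     - (if (e < #|F|)%N then 0 else c * (g`_(e - #|F|).+1 *+ (e - #|F|).+1)).
Proof.
move=> e0; rewrite Ag coefZ mulrBl coefB coefXnM coefXM !coef_deriv (gtn_eqF e0).
rewrite prednK // mulNr mulrBr opprB; case: ifP => _ //; by rewrite mulr0.
Qed.

Lemma coefA1 : A`_1 = c.
Proof. by have := congr1 (fun f : {poly F} => f`_0) dA; rewrite coef_deriv coefC. Qed.

(** When N does not divide e, only the linear term of A contributes to A(g) at e, and the equation
    reads c g_e = c e g_e. *)
Lemma natr_eq1_of_coef e : ~~ (N %| e)%N -> g`_e != 0 -> e%:R = 1 :> F.
Proof.
move=> Ne ge; have e_gt0 : (0 < e)%N by case: e Ne {ge} => //; rewrite dvdn0.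
have e_lt : (e < #|F|)%N.
  by rewrite (leq_trans _ sg) // ltnNge; apply: contra ge => /leq_sizeP->.
have := coef_comp_MVSP e e_gt0; rewrite e_lt subr0.
rewrite (coef_comp_power_supported chN N_gt1) //.
have sA0 : (0 < size A)%N by apply: leq_trans sA.
rewrite (big_pred1 (Ordinal sA0)) => [|i]; last first.
  rewrite /= -val_eqE /=; case: (nat_of_ord i) => [|j]; first by rewrite dvd1n.
  by apply: contraNF Ne; apply: dvdn_trans; rewrite expnS dvdn_mulr.
rewrite /= divn1 coefA1 expr1 => /(mulfI c0); rewrite -[_ *+ e]mulr_natr.
by move/esym/(canRL (mulKf ge)) => ->; rewrite mulVf.
Qed.

Let N_gt0 : (0 < N)%N := ltnW N_gt1.

Lemma natrN_eq0 : N%:R = 0 :> F.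
Proof.
have pN : pdiv N \in primes N by rewrite mem_primes pdiv_prime // pdiv_dvd N_gt0.
have pF : pdiv N \in [pchar F] by case/andP: chN => _ /allP; apply.
by apply/eqP; rewrite -(dvdn_pcharf pF) pdiv_dvd.
Qed.

Section OneOrbit.

Variable e : nat.
Hypotheses (Ne : ~~ (N %| e)%N) (ge : g`_e != 0).

Let e_gt0 : (0 < e)%N.
Proof. by case: e Ne => //; rewrite dvdn0. Qed.

(** This is the polynomial G of the overview; dividing the exponents by e makes it linearized.
    Truncation at [size g] loses nothing, since j < N^j <= N^j e. *)
Definition orbit_poly : {poly F} :=
  \sum_(j < size g) g`_(N ^ j * e) *: 'X^(N ^ j).

Lemma coef_orbit_poly j : orbit_poly`_(N ^ j) = g`_(N ^ j * e).
Proof.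
rewrite coef_sumMXn; have [ltj|lej] := ltnP j (size g).
  by rewrite (big_pred1 (Ordinal ltj)) // => i; rewrite eqn_exp2l // -val_eqE.
rewrite big1 => [|i]; last first.
  by rewrite eqn_exp2l // => /eqP ij; have := ltn_ord i; rewrite ij ltnNge lej.
rewrite nth_default // (leq_trans lej) // ltnW // (leq_trans (ltn_expl j N_gt1)) //.
by rewrite leq_pmulr.
Qed.

Lemma orbit_poly_supported : power_supported N orbit_poly.
Proof.
move=> m; rewrite coef_sumMXn; case: (pickP (fun j : 'I_(size g) => (N ^ j)%N == m)).
  by move=> j /eqP<- _; exists j.
by move=> no; rewrite big_pred0 ?eqxx.
Qed.

(** As N does not divide e, N^i divides N^j e exactly when i <= j, so both coefficients are sums of
    the same terms. *)
Lemma coef_comp_orbit_poly j :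
  (A \Po orbit_poly)`_(N ^ j) = (A \Po g)`_(N ^ j * e).
Proof.
rewrite !(coef_comp_power_supported chN N_gt1) //.
apply: eq_big => [i|i]; rewrite dvdn_Pexp2l //.
  have [leij|ltji] := leqP i j; first by rewrite dvdn_mulr // dvdn_exp2l.
  apply/esym/negbTE; apply: contra Ne; rewrite -(subnKC ltji) addSn -addnS expnD.
  rewrite dvdn_pmul2l ?expn_gt0 ?N_gt0 //; apply: dvdn_trans.
  by rewrite expnS dvdn_mulr.
move=> leij; rewrite -{1 2}(subnK leij) expnD mulnAC !mulnK ?expn_gt0 ?N_gt0 //.
by rewrite coef_orbit_poly.
Qed.

Lemma comp_orbit_poly_supported : power_supported N (A \Po orbit_poly).
Proof.
move=> m; rewrite (coef_comp_power_supported chN N_gt1) // => nz.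
have [i /andP[/dvdnP[a ->]]] : exists i : 'I_(size A), (N ^ i %| m)%N &&
    (orbit_poly`_(m %/ N ^ i) != 0).
  apply/existsP; apply: contraNT nz => /existsPn no; apply/eqP/big1 => i dv.
  have := no i; rewrite dv /= negbK => /eqP->.
  by rewrite expr0n gtn_eqF ?expn_gt0 ?N_gt0 // mulr0.
rewrite mulnK ?expn_gt0 ?N_gt0 // => /orbit_poly_supported[b ->].
by exists (b + i)%N; rewrite expnD.
Qed.

(** For j > 0 the number N^j e is zero in F, which kills the coefficient of X g'. Only X^q g'
    remains, and e0 = N^j e - q + 1 is 1 modulo N. *)
Lemma coef_comp_MVSP_pow j : (0 < j)%N -> (A \Po g)`_(N ^ j * e) != 0 ->
  exists e0, [/\ (N ^ j * e + 1 = #|F| + e0)%N, (e0 < size g)%N,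
    ~~ (N %| e0)%N & (A \Po g)`_(N ^ j * e) = - (c * g`_e0)].
Proof.
move=> j_gt0; set E := (N ^ j * e)%N.
have E_gt0 : (0 < E)%N by rewrite muln_gt0 expn_gt0 N_gt0.
have NE : (N %| E)%N by rewrite dvdn_mulr // dvdn_exp.
have NR m : (N %| m)%N -> m%:R = 0 :> F.
  by case/dvdnP=> a ->; rewrite natrM natrN_eq0 mulr0.
rewrite coef_comp_MVSP // -mulr_natr NR // mulr0 mulr0 add0r.
case: ltnP => [|leq_E]; first by rewrite oppr0 eqxx.
set e0 := (E - #|F|).+1.
have e0E : (E + 1 = #|F| + e0)%N by rewrite addn1 /e0 addnS subnKC.
have e0R : e0%:R = 1 :> F.
  by rewrite /e0 -addn1 natrD natrB // (NR E) // (NR #|F|) // subr0 add0r.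
rewrite -mulr_natr e0R mulr1 => nz; exists e0; split=> //.
  rewrite ltnNge; apply: contra nz => /leq_sizeP->//; by rewrite mulr0 oppr0.
by rewrite /e0 -addn1 dvdn_addr ?dvdn_sub // dvdn1 gtn_eqF.
Qed.

(** Here N^s is the degree of A(G). Since A(G) has no terms other than X and X^(N^s),
    [root_comp_fixed] applies with a = -c g_e0 and b = c g_e. *)
Lemma MVSP_orbit :
  exists s e0, [/\ (0 < s)%N, (N ^ s * e + 1 = #|F| + e0)%N, (e0 < size g)%N,
    ~~ (N %| e0)%N &
    (forall u, A.[u] = 0 -> u ^+ (N ^ s) = u) /\ c * g`_e0 = (c * g`_e) ^+ (N ^ s)].
Proof.
pose B := A \Po orbit_poly.
have B1 : B`_1 = c * g`_e.
  have := coef_comp_orbit_poly 0; rewrite expn0 mul1n => ->.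
  have e_lt : (e < #|F|)%N.
    by rewrite (leq_trans _ sg) // ltnNge; apply: contra ge => /leq_sizeP->.
  by rewrite coef_comp_MVSP // e_lt subr0 -mulr_natr natr_eq1_of_coef // mulr1.
have O1 : orbit_poly`_1 = g`_e by have := coef_orbit_poly 0; rewrite expn0 mul1n.
have sO : (1 < size orbit_poly)%N.
  by rewrite ltnNge; apply: contra ge => /leq_sizeP/(_ 1%N isT); rewrite O1 => ->.
(* The degree of A(G) is at least deg A >= 2, which excludes s = 0. *)
have sB : (2 < size B)%N.
  rewrite -ltn_predRL size_comp_poly.
  rewrite (@leq_trans (size A).-1) ?ltn_predRL // leq_pmulr // ltn_predRL //.
have B_neq0 : lead_coef B != 0 by rewrite lead_coef_eq0 -size_poly_gt0 (leq_trans _ sB).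
have [s sE] := comp_orbit_poly_supported _ B_neq0.
have s_gt0 : (0 < s)%N.
  by case: s sE => // /eqP; rewrite expn0 gtn_eqF // ltn_predRL.
have Bs0 : B`_(N ^ s) != 0 by rewrite -sE.
have Bs : B`_(N ^ s) = (A \Po g)`_(N ^ s * e) by rewrite coef_comp_orbit_poly.
have [] := coef_comp_MVSP_pow s s_gt0; first by rewrite -Bs.
move=> e0 [se0 e0_lt Ne0 Age0]; rewrite -Bs in Age0.
have BE : B = - (c * g`_e0) *: 'X^(N ^ s) + (c * g`_e) *: 'X.
  apply/polyP => m; rewrite coefD !coefZ coefXn coefX.
  have [->|mNs] := eqVneq m (N ^ s)%N.
    rewrite mulr1 (_ : (_ == 1)%N = false) ?mulr0 ?addr0 //.
    by rewrite gtn_eqF // -(expn0 N) ltn_exp2l.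
  rewrite mulr0 add0r; have [->|m1] := eqVneq m 1%N; first by rewrite mulr1.
  rewrite mulr0; apply/eqP; apply: contraTT isT => Bm.
  have [j mE] := comp_orbit_poly_supported _ Bm.
  have j_gt0 : (0 < j)%N by case: j mE => // mE; rewrite mE eqxx in m1.
  rewrite mE coef_comp_orbit_poly in Bm.
  have [e1 [je1 e1_lt Ne1 _]] := coef_comp_MVSP_pow j j_gt0 Bm.
  (* Two such exponents differ by a factor at least [N], but both lie in
     [q, 2q - 1). *)
  have no i1 i2 a1 a2 : (i1 < i2)%N -> (N ^ i1 * e + 1 = #|F| + a1)%N ->
      (N ^ i2 * e + 1 = #|F| + a2)%N -> (0 < a1)%N -> (a2 < size g)%N -> False.
    move=> lt12 E1 E2 a1_gt0 a2_lt.
    have : (2 * (N ^ i1 * e) <= N ^ i2 * e)%N.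
      rewrite mulnA leq_mul2r; apply/orP; right.
      rewrite (leq_trans _ (_ : N ^ i1.+1 <= _)%N) ?leq_exp2l //.
      by rewrite expnS leq_mul2r N_gt1 orbT.
    have a2q : (a2 < #|F|)%N := leq_trans a2_lt sg.
    move: E1 E2 a1_gt0 a2q {a2_lt lt12}.
    move: (N ^ i1 * e)%N (N ^ i2 * e)%N #|F| => x y q E1 E2 a1_gt0 a2q le2.
    have leqx : (q <= x)%N by rewrite -(leq_add2r 1) E1 leq_add2l.
    have : (y + 1 < q + q)%N by rewrite E2 ltn_add2l.
    by rewrite addnn -mul2n addn1 ltnNge leqW // (leq_trans _ le2) // leq_mul2l.
  have pos a : ~~ (N %| a)%N -> (0 < a)%N by case: a => //; rewrite dvdn0.
  case: (ltngtP s j) => [sj|js|sj].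
  - by case: (no s j e0 e1); rewrite ?pos.
  - by case: (no j s e1 e0); rewrite ?pos.
  - by rewrite mE sj eqxx in mNs.
(* The roots needed by [root_comp_fixed] exist over L; its conclusions return to F because [iota] is
   injective. *)
have chL : [pchar L].-nat N by rewrite (eq_pnat _ (fmorph_pchar iota)).
have BL : map_poly iota A \Po map_poly iota orbit_poly =
    iota (- (c * g`_e0)) *: 'X^(N ^ s) + iota (c * g`_e) *: 'X.
  rewrite -map_comp_poly -/B BE rmorphD /= !linearZ /= map_polyXn map_polyX //.
have root_map u : (map_poly iota A).[iota u] = iota A.[u] by rewrite horner_map.
have [] := root_comp_fixed L (N ^ s) _ _ _ _ _ _ _ _ _ _ _ BL.
- by rewrite pnatX chL.
- by rewrite -(expn0 N) ltn_exp2l.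
- by rewrite map_monic.
- by rewrite -(rmorph0 iota) root_map A0.
- by rewrite -{1}(rmorph1 iota) root_map A1 rmorph0.
- by rewrite fmorph_eq0 -Age0.
- by rewrite fmorph_eq0 mulf_neq0.
move=> fixA cge0; exists s, e0; split=> //; split=> [u Au|].
  by apply: (fmorph_inj iota); rewrite rmorphXn fixA // root_map Au rmorph0.
by apply: (fmorph_inj iota); rewrite [RHS]rmorphXn; apply: oppr_inj; rewrite -cge0 rmorphN.
Qed.

End OneOrbit.
End Orbits.

(** * Solving f^Q - f = A(g) by telescoping along the orbits *)

Lemma sum_exp_pchar (R : comNzRingType) (I : Type) (r : seq I) (P : pred I)
    (E : I -> R) (N : nat) :
  [pchar R].-nat N -> (\sum_(i <- r | P i) E i) ^+ N = \sum_(i <- r | P i) E i ^+ N.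
Proof.
move=> chN; have N_gt0 : (0 < N)%N by case/andP: chN.
elim/big_rec2: _ => [|i y x _ <-]; first by rewrite expr0n gtn_eqF.
by rewrite exprDn_pchar.
Qed.

(** The witness h is the sum of t^(N^j) over j < J. *)
Lemma exp_subr_telescope (R : comNzRingType) (N J : nat) (t : R) :
  [pchar R].-nat N -> exists h : R, h ^+ N - h = t ^+ (N ^ J) - t.
Proof.
move=> chN; have N_gt0 : (0 < N)%N by case/andP: chN.
elim: J => [|J [h hE]].
  by exists 0; rewrite expr0n gtn_eqF // expn0 expr1 !subrr.
exists (h + t ^+ (N ^ J)); rewrite exprDn_pchar // -exprM -expnSr.
by rewrite opprD addrACA hE addrAC addrCA subrr addr0 addrC.
Qed.

Section Descent.

Context {F : finFieldType} {L : closedFieldType} (iota : {rmorphism F -> L}).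
Context {N d : nat} {A g : {poly F}} {c : F}.
Hypotheses (chN : [pchar F].-nat N) (N_gt1 : (1 < N)%N).
Hypotheses (A_monic : A \is monic) (sA : (2 < size A)%N).
Hypotheses (A0 : A.[0] = 0) (A1 : A.[1] = 0).
Hypotheses (psA : power_supported N A) (dA : A^`() = c%:P) (c0 : c != 0).
Hypotheses (Nq : (N %| #|F|)%N) (sg : (size g <= #|F|)%N).
Hypothesis Ag : A \Po g = - c *: (('X^#|F| - 'X) * g^`()).
Hypothesis cQ : c ^+ (N ^ d) = c.
Hypothesis d_min : forall s, (0 < s)%N ->
  (forall u, A.[u] = 0 -> u ^+ (N ^ s) = u) -> (d %| s)%N.

Let N_gt0 : (0 < N)%N := ltnW N_gt1.
Let Q := (N ^ d)%N.
Let I := 'I_(size g).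
Let E (e : I) := ~~ (N %| e)%N && (g`_e != 0).

Let chQ : [pchar {poly F}].-nat Q.
Proof. by rewrite pchar_poly_nat // pnatX chN. Qed.

(** The component [x.2] is the end e0 of the orbit and [x.1] a telescoping sum, available because d
    divides s. The implication makes the statement total in e, so that a choice function can be
    extracted. *)
Let orbit_step (e : I) : exists x : {poly F} * I, E e ->
  [/\ exists s, (N ^ s * e + 1 = #|F| + x.2)%N, E x.2 &
      x.1 ^+ Q - x.1 = g`_x.2 *: 'X^(#|F|.-1 + x.2) - g`_e *: 'X^e].
Proof.
have [|notE] := boolP (E e); last by exists (0, e).
case/andP=> Ne ge.
have [s [e0 [s_gt0 se e0_lt Ne0 [fixA cge]]]] :=
  MVSP_orbit (iota := iota) chN N_gt1 A_monic sA A0 A1 psA dA c0 Nq sg Ag e Ne ge.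
have [J sE] := dvdnP (d_min s s_gt0 fixA).
have NsE : (N ^ s = Q ^ J)%N by rewrite sE mulnC expnM.
have [h hE] := exp_subr_telescope _ Q J (g`_e *: 'X^e) chQ.
have ge0 : g`_e0 = g`_e ^+ (N ^ s).
  by apply: (mulfI c0); rewrite cge exprMn NsE (exprX_fix J cQ).
have F_gt0 : (0 < #|F|)%N by apply/card_gt0P; exists 0.
exists (h, Ordinal e0_lt) => _; split=> /=.
- by exists s.
- by rewrite /E /= Ne0 ge0 expf_neq0.
rewrite hE exprZn -exprM -NsE -ge0; congr (_ *: 'X^_ - _).
by apply/eqP; rewrite -(eqn_add2r 1) mulnC se addn1 -addSn prednK.
Qed.

(** The relations of [orbit_step] are added over all e in [E]. The map from e to e0 permutes these
    exponents, so the right-hand sides add up to (X^(q-1) - 1) S, where S is the sum of the g_e X^e.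
    Finally S = X g', because e = 1 in F for these e and e = 0 in F when N divides e. *)
Lemma MVSP_descent :
  exists f : {poly F}, f ^+ (N ^ d) - f = - c *: (('X^#|F| - 'X) * g^`()).
Proof.
have [x xE] := fin_all_exists orbit_step.
(* The identity outside [E] turns injectivity into bijectivity on the whole finite index type. *)
pose phi e := if E e then (x e).2 else e.
have Ephi e : E (phi e) = E e.
  by rewrite /phi; case: ifP => // Ee; have [] := xE e Ee.
(* [e] is recovered from [N ^ s * e] because [N] does not divide it. *)
have phi_inj : injective phi.
  move=> e1 e2; have := Ephi e1; have := Ephi e2; rewrite /phi.
  case: ifP => E2; case: ifP => E1 // Ex2 Ex1 e12; do ?by move: Ex1; rewrite e12 Ex2.
  have [[s1 se1] _ _] := xE e1 E1; have [[s2 se2] _ _] := xE e2 E2.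
  have {se1 se2} : (N ^ s1 * e1 = N ^ s2 * e2)%N.
    by apply/eqP; rewrite -(eqn_add2r 1) se1 se2 e12.
  have aux m n (i j : nat) : (m < n)%N -> ~~ (N %| i)%N -> (N ^ m * i <> N ^ n * j)%N.
    move=> ltmn /negP Ni; rewrite -(subnKC ltmn) addSn -addnS expnD -mulnA => /eqP.
    rewrite eqn_pmul2l ?expn_gt0 ?N_gt0 // => /eqP iE; apply: Ni.
    by rewrite iE expnS -mulnA dvdn_mulr.
  move: E1 E2 => /andP[N1 _] /andP[N2 _].
  case: (ltngtP s1 s2) => [lt12 /aux|lt21 /esym/aux|->]; [by case|by case|].
  by move/eqP; rewrite eqn_pmul2l ?expn_gt0 ?N_gt0 // => /eqP/val_inj.
pose S := \sum_(e : I | E e) g`_e *: 'X^e.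
have SE : S = 'X * g^`().
  apply/polyP => i; rewrite coefXM coef_sumMXn coef_deriv.
  have gi : g`_i *+ i = if ~~ (N %| i)%N && (g`_i != 0) then g`_i else 0.
    case: ifP => [/andP[Ni gi]|/negbT].
      by rewrite -mulr_natr (natr_eq1_of_coef chN N_gt1 sA psA dA c0 sg Ag i Ni gi) mulr1.
    rewrite negb_and !negbK => /orP[/dvdnP[a ->]|/eqP->]; last by rewrite mul0rn.
    by rewrite -mulr_natr natrM (natrN_eq0 chN N_gt1) !mulr0.
  have -> : (if i == 0%N then 0 else g`_i.-1.+1 *+ i.-1.+1) = g`_i *+ i.
    by case: i {gi} => [|i] /=; rewrite ?mulr0n.
  rewrite gi; have [lti|lei] := ltnP i (size g); last first.
    rewrite nth_default // eqxx andbF big1 // => e /andP[_ /eqP ei].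
    by have := ltn_ord e; rewrite ei ltnNge lei.
  case: ifP => Ei.
    rewrite (big_pred1 (Ordinal lti)) // => e; rewrite /= -val_eqE /=.
    by apply/andP/eqP => [[_ /eqP]//|ei]; rewrite /E ei Ei.
  rewrite big_pred0 // => e; apply/negP => /andP[Ee /eqP ei].
  by rewrite /E ei Ei in Ee.
have F_gt0 : (0 < #|F|)%N by apply/card_gt0P; exists 0.
have SE' : \sum_(e : I | E e) g`_(x e).2 *: 'X^(#|F|.-1 + (x e).2) = 'X^(#|F|.-1) * S.
  rewrite /S [X in _ * X](reindex_inj phi_inj) mulr_sumr.
  apply: eq_big => e; rewrite ?Ephi // => Ee.
  by rewrite /phi Ee -scalerAr exprD.
exists (- c *: \sum_(e : I | E e) (x e).1).
rewrite exprZn exprNn_pchar ?pnatX ?chN // cQ sum_exp_pchar // -scalerBr -sumrB.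
congr (_ *: _); under eq_bigr => e Ee do have [_ _ ->] := xE e Ee.
rewrite sumrB SE' -/S -{2}[S]mul1r -mulrBl SE mulrA; congr (_ * _).
by rewrite mulrBl mul1r -exprSr prednK.
Qed.

End Descent.

(** * Finite subfields of L that lie in the image of F *)

Section GFset.

Context {F : finFieldType} {L : closedFieldType} (iota : {rmorphism F -> L}).

Lemma mem_GFset (M : nat) (a : F) : (a \in GFset iota M) = (a ^+ M == a).
Proof. by rewrite !inE -rmorphXn (inj_eq (fmorph_inj iota)). Qed.

(** X^q - X already splits over F, hence has no further roots in L. *)
Lemma fixed_in_image (y : L) : y ^+ #|F| = y -> exists a : F, iota a = y.
Proof.
move=> yq; have : root (map_poly iota ('X^#|F| - 'X)) y.
  by rewrite rmorphB /= map_polyXn map_polyX rootE !hornerE yq subrr.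
rewrite finField_genPoly rmorph_prod rootE horner_prod => /prodf_eq0[a _].
rewrite /= map_polyXsubC !hornerE subr_eq0 => /eqP->; by exists a.
Qed.

Lemma card_GFset (p m r : nat) : p \in [pchar F] -> (0 < m)%N ->
  #|F| = ((p ^ m) ^ r)%N -> #|GFset iota (p ^ m)| = (p ^ m)%N.
Proof.
move=> pF m0 cF; have pL : p \in [pchar L] by rewrite (fmorph_pchar iota).
have [_ [s [us szs sE]]] := GF_subfield pL m0.
rewrite -[RHS]szs cardE -(size_map iota); apply/perm_size/uniq_perm => //.
  by rewrite map_inj_uniq ?enum_uniq //; apply: fmorph_inj.
move=> y; rewrite sE; apply/mapP/idP => [[a]|yN].
  by rewrite mem_enum inE => aN ->.
have [|a ay] := fixed_in_image y.
  by rewrite cF; apply: exprX_fix; apply/eqP; move: yN; rewrite inE.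
by exists a => //; rewrite mem_enum inE ay.
Qed.

End GFset.

(** * Construction of M and transfer between the equations of U and of F_Q *)

Theorem theorem2p4 (p n k d : nat) (F : finFieldType) (L : closedFieldType)
    (iota : {rmorphism F -> L}) (U : {set F}) :
  prime p ->
  #|F| = (p ^ n)%N ->
  (* L is an algebraic closure of F *)
  integralRange iota ->
  (0 < k)%N -> (k %| n)%N ->
  is_GF_subspace iota (p ^ k) U ->
  1 \in U ->
  (2 < #|U|)%N ->
  (* d is the least positive integer such that U is contained in F_(p^(dk)) *)
  (0 < d)%N -> (d <= n %/ k)%N ->
  {in U, forall u : F, iota u \in GF L (p ^ (d * k))} ->
  (forall e : nat, (0 < e)%N ->
     {in U, forall u : F, iota u \in GF L (p ^ (e * k))} -> (d <= e)%N) ->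
  let A : {poly F} := \prod_(u in U) ('X - u%:P) in
  exists M : {poly F},
    [/\ M \is monic,
        linearized p k (map_poly iota M),
        A \Po M = 'X^(p ^ (d * k)) - 'X /\ M \Po A = 'X^(p ^ (d * k)) - 'X,
        (forall y : L, y \in GF L (p ^ (d * k)) -> exists a : F, iota a = y) &
        forall g : {poly F},
          MVSP_with_values U g <->
          exists2 f : {poly F},
            MVSP_with_values (GFset iota (p ^ (d * k))) f & g = M \Po f].
Proof.
move=> p_pr cF _ k_gt0 k_n subU U1 U_gt2 d_gt0 d_le U_GF d_min0 A.
have pF : p \in [pchar F] by apply: card_finPcharP cF p_pr.
set N := (p ^ k)%N in subU; set n' := (n %/ k)%N in d_le.
have QE : (p ^ (d * k) = N ^ d)%N by rewrite mulnC expnM.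
set Q := (N ^ d)%N in QE; rewrite QE in U_GF *.
have n'_gt0 : (0 < n')%N := leq_trans d_gt0 d_le.
have cFN : #|F| = (N ^ n')%N by rewrite cF -expnM mulnC divnK.
have chN : [pchar F].-nat N by rewrite pnatX pnatE ?pF.
have N_gt1 : (1 < N)%N by rewrite -(exp1n k) ltn_exp2r // prime_gt1.
have chQ : [pchar F].-nat Q by rewrite pnatX chN.
have Q_gt1 : (1 < Q)%N by rewrite -(exp1n d) ltn_exp2r.
have Uq u : u \in U -> u ^+ Q = u.
  by move=> Uu; apply/eqP; rewrite -(mem_GFset iota) inE U_GF.
(* Minimality sharpens to divisibility: if powering by N^s fixes U pointwise, so does powering by
   N^(s mod d). *)
have d_min s : (0 < s)%N -> (forall u, u \in U -> u ^+ (N ^ s) = u) -> (d %| s)%N.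
  move=> s_gt0 Us; have [r0|r_gt0] := posnP (s %% d).
    by rewrite /dvdn r0 eqxx.
  have := ltn_pmod s d_gt0; rewrite ltnNge d_min0 // => u Uu.
  rewrite inE -rmorphXn (inj_eq (fmorph_inj iota)) mulnC expnM -/N.
  rewrite -{2}(Us u Uu) {2}(divn_eq s d) expnD exprM mulnC expnM.
  by rewrite (exprX_fix _ (Uq u Uu)).
(* Powering by q = N^n' fixes all of F; the divisibility makes q a power of Q, so F_Q lies in F. *)
have d_n' : (d %| n')%N by apply: d_min => [|u _]; rewrite -?cFN ?expf_card.
have cFQ : #|F| = (Q ^ (n' %/ d))%N by rewrite cFN /Q -expnM mulnC divnK.
pose K := GFset iota Q.
have memK x : (x \in K) = (x ^+ Q == x) by rewrite mem_GFset.
have cK : #|K| = Q by rewrite /K -QE (card_GFset iota p _ (n' %/ d)) ?muln_gt0 ?d_gt0 // QE.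
have card_fix : #|[set x : F | x ^+ N == x]| = N.
  rewrite -[RHS](card_GFset iota p k n') //; apply: eq_card => x.
  by rewrite mem_GFset inE.
have fixU : fixed_subspace (N := N) U.
  case: subU => U0 UD UZ; split=> // l u lN Uu; apply: UZ => //.
  by rewrite mem_GFset lN.
have fixK : fixed_subspace (N := N) K.
  split=> [|x y|l x lN]; rewrite !memK.
  - by rewrite expr0n gtn_eqF // ltnW.
  - by move=> /eqP xQ /eqP yQ; rewrite exprDn_pchar // xQ yQ.
  - by move=> /eqP xQ; rewrite exprMn xQ exprX_fix.
have UK : U \subset K by apply/subsetP => u /Uq uQ; rewrite memK uQ.
have psA := fixed_subspace_power_supported chN N_gt1 card_fix U fixU.
have KE : 'X^Q - 'X = set_poly K.
  have sX : (size (- 'X : {poly F}) < size ('X^Q : {poly F}))%N.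
    by rewrite size_polyN size_polyX size_polyXn ltnS.
  apply: eq_set_poly; rewrite ?monicE ?lead_coefDl ?lead_coefXn //.
    by rewrite size_polyDl // size_polyXn cK.
  by move=> x; rewrite memK !hornerE => /eqP->; rewrite subrr.
have AE : A = set_poly U by [].
have AQ : A \Po 'X^Q = A ^+ Q.
  rewrite /A rmorph_prod -prodrXl; apply: eq_bigr => u Uu /=.
  rewrite comp_polyB comp_polyX comp_polyC exprDn_pchar ?pchar_poly_nat //.
  by rewrite exprNn_pchar ?pchar_poly_nat // -polyC_exp Uq.
have N1 : (-1) ^+ N = -1 :> F by rewrite exprNn_pchar // expr1n.
(* M will be the polynomial of V = A(K): then M(A) is monic, vanishes on K and has degree #V #U =
   #K. *)
pose V := horner A @: K.
have VK : V \subset K.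
  apply/subsetP => _ /imsetP[x Kx ->]; rewrite memK -horner_exp -AQ horner_comp.
  by move: Kx; rewrite hornerXn memK => /eqP->.
have A0 : A.[0] = 0 by apply/eqP; rewrite set_poly_eq0; case: subU.
have A1 : A.[1] = 0 by apply/eqP; rewrite set_poly_eq0.
have fixV : fixed_subspace (N := N) V.
  have [K0 KD KZ] := fixK.
  have AD x y l : l ^+ N = l -> A.[x + l * y] = A.[x] + l * A.[y].
    exact: power_supported_horner.
  split=> [|_ _ /imsetP[x Kx ->] /imsetP[y Ky ->]|l _ lN /imsetP[x Kx ->]].
  - by apply/imsetP; exists 0.
  - by apply/imsetP; exists (x + y); rewrite ?KD // -{2}[y]mul1r AD ?expr1n ?mul1r.
  - by apply/imsetP; exists (l * x); rewrite ?KZ // -[l * x]add0r AD // A0 add0r.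
have psV := fixed_subspace_power_supported chN N_gt1 card_fix V fixV.
have cKV : #|K| = (#|V| * #|U|)%N.
  exact: (card_fixed_subspace_image chN N_gt1 card_fix).
have V_gt0 : (0 < #|V|)%N by apply/card_gt0P; exists 0; case: fixV.
pose M := set_poly V.
have sA1 : (1 < size A)%N by rewrite AE size_set_poly ltnS (ltn_trans _ U_gt2).
have MA : M \Po A = 'X^Q - 'X.
  rewrite KE; apply: eq_set_poly.
  - rewrite monicE lead_coef_comp // (monicP (set_poly_monic V)).
    by rewrite (monicP (set_poly_monic U)) expr1n mulr1.
  - rewrite -[LHS]prednK ?size_comp_poly ?size_set_poly ?cKV //.
    by rewrite size_poly_gt0 comp_poly_eq0 // monic_neq0 // set_poly_monic.
  - by move=> x Kx; rewrite horner_comp; apply/eqP; rewrite set_poly_eq0 imset_f.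
(* Composing on the right with A, A(M(A)) = A(X^Q - X) = A^Q - A, which is X^Q - X evaluated at A;
   the nonconstant A cancels. *)
have AM : A \Po M = 'X^Q - 'X.
  apply/eqP; rewrite -subr_eq0 -(comp_poly_eq0 _ sA1) comp_polyB -comp_polyA MA.
  rewrite -scaleN1r (power_supported_comp chN) // scaleN1r comp_polyXr AQ.
  by rewrite comp_polyB rmorphXn /= comp_polyX scaleN1r subrr.
(* A(M) vanishes on K, so M(K) lies in U; the fibres are cosets of V, and #K = #V #U forces
   equality. *)
have MK : horner M @: K = U.
  apply/eqP; rewrite eqEcard; apply/andP; split.
    apply/subsetP => _ /imsetP[x Kx ->]; rewrite -set_poly_eq0 -horner_comp.
    by move: Kx; rewrite AM !hornerE memK subr_eq0.
  have := card_fixed_subspace_image chN N_gt1 card_fix V K fixV fixK VK.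
  by rewrite cKV mulnC => /eqP; rewrite eqn_pmul2r // => /eqP->.
set c := A`_1; have dA : A^`() = c%:P by apply: power_supported_deriv chN N_gt1 _ psA.
set m := M`_1; have dM : M^`() = m%:P by apply: power_supported_deriv chN N_gt1 _ psV.
have dK : (set_poly K)^`() = (-1)%:P.
  have psK := fixed_subspace_power_supported chN N_gt1 card_fix K fixK.
  rewrite (power_supported_deriv chN N_gt1 _ psK) -KE coefB coefX coefXn.
  by rewrite (ltn_eqF Q_gt1) sub0r.
(* This is the chain rule applied to M(A) = X^Q - X. *)
have mc : m * c = -1.
  apply: polyC_inj; rewrite -dK -KE -MA deriv_comp dA dM comp_polyC polyCM.
  by [].
have c0 : c != 0.
  by apply: contra_eq_neq mc => ->; rewrite mulr0 eq_sym oppr_eq0 oner_neq0.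
have cQ : c ^+ Q = c.
  have := congr1 (fun f : {poly F} => f`_Q) AQ.
  by rewrite coef_comp_poly_Xn ?coef_exp_pchar ?dvdnn ?divnn ?(ltnW Q_gt1).
have K_gt1 : (1 < #|K|)%N by rewrite cK.
have dMf f : (M \Po f)^`() = m *: f^`().
  by rewrite deriv_comp dM comp_polyC mul_polyC.
have U_gt1 := ltnW U_gt2.
have n1_neq0 : -1 != 0 :> F by rewrite oppr_eq0 oner_neq0.
exists M; split=> //.
- exact: set_poly_monic.
- apply: power_supported_linearized => // e.
  by rewrite coef_map fmorph_eq0; apply: psV.
- move=> y; rewrite inE => /eqP yQ; apply: fixed_in_image.
  by rewrite cFQ exprX_fix.
move=> g; split=> [gU|[f fK ->]]; last first.
  have [sf fE] := (MVSP_with_valuesP K (-1) f K_gt1 n1_neq0 dK).1 fK.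
  apply/(MVSP_with_valuesP U c (M \Po f) U_gt1 c0 dA); split.
    rewrite -ltn_predRL size_comp_poly size_set_poly muln_gt0 V_gt0.
    by rewrite ltn_predRL.
  rewrite -AE comp_polyA AM KE fE dMf -scalerAr scalerA opprK scale1r.
  by rewrite mulNr [c * m]mulrC mc opprK scale1r.
have [sg Ag] := (MVSP_with_valuesP U c g U_gt1 c0 dA).1 gU.
(* A degree of at least q would leave a single value, against #U > 2. *)
have sgF : (size g <= #|F|)%N.
  have [[_ cV] VU] := gU; rewrite leqNgt; apply: contraL U_gt2 => lt_g.
  rewrite -VU cV divn_small // subn1 -subn1 ltn_subLR; last first.
    by apply/card_gt0P; exists 0.
  by rewrite add1n prednK // ltnW.
have sA2 : (2 < size A)%N by rewrite AE size_set_poly.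
have Nq : (N %| #|F|)%N by rewrite cFN dvdn_exp.
have d_minA s : (0 < s)%N ->
    (forall u, A.[u] = 0 -> u ^+ (N ^ s) = u) -> (d %| s)%N.
  move=> s_gt0 As; apply: d_min => // u Uu; apply: As.
  by apply/eqP; rewrite set_poly_eq0.
have [f0 f0E] := MVSP_descent iota chN N_gt1 (set_poly_monic U) sA2 A0 A1 psA dA
  c0 Nq sgF Ag cQ d_minA.
have AMf f : A \Po (M \Po f) = f ^+ Q - f.
  by rewrite comp_polyA AM comp_polyB rmorphXn /= comp_polyX.
have Az : A \Po (M \Po f0 - g) = 0.
  rewrite -scaleN1r (power_supported_comp chN) // scaleN1r AMf f0E -Ag.
  by rewrite subrr.
have /size1_polyC zE : (size (M \Po f0 - g)%R <= 1)%N.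
  rewrite leqNgt; apply/negP => sz; move/eqP: Az; rewrite comp_poly_eq0 //.
  by rewrite (negPf (monic_neq0 (set_poly_monic U))).
set u := (M \Po f0 - g)`_0 in zE.
have Uu : u \in U.
  by move/eqP: Az; rewrite zE comp_polyCr polyC_eq0 set_poly_eq0.
(* The constant error u is M(v) with v in K; replacing [f0] by [f0] - v removes it. *)
have [v Kv uE] : exists2 v, v \in K & u = M.[v] by apply/imsetP; rewrite MK.
pose f := f0 - v%:P.
have gE : g = M \Po f.
  rewrite /f -scaleN1r (power_supported_comp chN) // scaleN1r comp_polyCr -uE -zE.
  by rewrite opprB addrC subrK.
exists f => //; apply/(MVSP_with_valuesP K (-1) f K_gt1 n1_neq0 dK).
split.
  rewrite ltnNge; apply: contraL sg => /size1_polyC fC.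
  by rewrite -leqNgt gE fC comp_polyCr size_polyC leq_b1.
(* Here f^Q - f = A(M(f)) = A(g), and g' = m f' with m c = -1 turns the equation of U into that of
   K. *)
rewrite -KE -AM -comp_polyA -gE Ag gE dMf -scalerAr scalerA opprK scale1r.
by rewrite mulNr [c * m]mulrC mc opprK scale1r.
Qed.
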